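(* Fix an integer $L_2\ge 1$. Then for every integer $L_1$ with $1\le L_1\le L_2$ and every real $a>0$, $$J_{L_2}(r,a)=J_{L_1}(r)+O\!\left(r^{L_1+1}\right)\qquad\text{as } r\to 0^+,$$ where $J_L(r,a)$ denotes the stationary current of the open totally asymmetric simple exclusion process on $2L$ sites with entry and exit rates equal to $a$ and with a blockage of rate $r$ at the central bond, and $J_L(r)=J_L(r,1)$.
   Context: Open totally asymmetric simple exclusion process with a blockage: for an integer $L\ge1$ and rates $r>0$, $a>0$, consider the continuous-time Markov chain on configurations $\eta=(\eta(-L+1),\eta(-L+2),\dots,\eta(L))\in\{0,1\}^{2L}$, where $\eta(k)=1$ means site $k$ is occupied by a particle and $\eta(k)=0$ means it is empty. The transitions are: (i) if $\eta(-L+1)=0$, a particle is added at site $-L+1$ at rate $a$; (ii) for each $i\in\{-L+1,\dots,L-1\}$ with $i\neq 0$, if $\eta(i)=1$ and $\eta(i+1)=0$, the particle at $i$ jumps to $i+1$ at rate $1$; (iii) if $\eta(0)=1$ and $\eta(1)=0$, the particle at $0$ jumps to $1$ at rate $r$; (iv) if $\eta(L)=1$, the particle at site $L$ is removed at rate $a$. No other transitions occur. This chain has a unique stationary distribution; $J_L(r,a)$ is the stationary current, i.e. $J_L(r,a)=r\,\Pr(\eta(0)=1,\ \eta(1)=0)$ in the stationary distribution (equivalently, the stationary expected rate of particle passage across any bond, or of entry or exit of particles). Write $J_L(r):=J_L(r,1)$. The implied constant in $O(\cdot)$ may depend on $L_1$, $L_2$ and $a$. *)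

(* Defs.v *)
From HB Require Import structures.
From mathcomp Require Import all_boot all_order all_algebra.
From mathcomp Require Import ring.
From mathcomp Require Import all_classical all_reals all_analysis.
Set Implicit Arguments.
Unset Strict Implicit.
Unset Printing Implicit Defensive.
Import Order.TTheory GRing.Theory Num.Theory.
Import numFieldNormedType.Exports.
Local Open Scope ring_scope.

Section FiniteMarkovChain.
Variables (R : realType) (T : finType).
Implicit Types (q : T -> T -> R) (p : {ffun T -> R}).

(* q x y is the jump rate from x to y; the values q x x cancel. *)
Definition balanced q p :=
  forall y, \sum_x p x * q x y = p y * \sum_z q y z.

Definition is_stationary q p :=
  [/\ forall x, 0 <= p x, \sum_x p x = 1 & balanced q p].

Lemma balanced_norm q p : (forall x y, 0 <= q x y) ->
  balanced q p -> balanced q [ffun x => `|p x|].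
Proof.
move=> q0 bp.
pose d (y : T) : R := \sum_x `|p x| * q x y - `|p y| * \sum_z q y z.
have d0 y : 0 <= d y.
  rewrite /d subr_ge0 -[X in _ * X]ger0_norm; last exact: sumr_ge0.
  rewrite -normrM -bp; apply: le_trans (ler_norm_sum _ _ _) _.
  by apply: ler_sum => x _; rewrite normrM (ger0_norm (q0 _ _)).
have sd : \sum_y d y = 0.
  rewrite big_split /= exchange_big sumrN /=; apply/eqP.
  by rewrite subr_eq0; apply/eqP/eq_bigr => x _; rewrite mulr_sumr.
move=> y; rewrite ffunE; under eq_bigr => x _ do rewrite ffunE.
apply/eqP; rewrite -subr_eq0; apply/eqP.
have dy : d y = 0 by apply: (psumr_eq0P _ sd) => // i _; exact: d0.
exact: dy.
Qed.

Lemma balancedD q p1 p2 c : balanced q p1 -> balanced q p2 ->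
  balanced q [ffun x => p1 x + c * p2 x].
Proof.
move=> b1 b2 y; under eq_bigr => x _ do rewrite ffunE mulrDl -mulrA.
by rewrite big_split /= -mulr_sumr b1 b2 ffunE mulrDl mulrA.
Qed.

Lemma balanced_eq0 q p e : (forall x y, 0 <= q x y) ->
  (forall x, connect (fun x y => 0 < q x y) x e) ->
  (forall x, 0 <= p x) -> balanced q p -> p e = 0 -> forall x, p x = 0.
Proof.
move=> q0 ce p0 bp pe x; have /connectP[s] := ce x.
elim: s x => [|z s IH] x /=; first by move=> _ <-.
case/andP=> qxz /IH{}IH /IH pz.
have s0 : \sum_x p x * q x z = 0 by rewrite bp pz mul0r.
have /eqP : p x * q x z = 0.
  by apply: (psumr_eq0P _ s0) => // i _; exact: mulr_ge0.
by rewrite mulf_eq0 (gt_eqF qxz) orbF => /eqP.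
Qed.

Lemma exists_balanced q (e : T) : exists2 p, balanced q p & exists x, p x != 0.
Proof.
pose G : 'M[R]_#|T| := \matrix_(i, j)
  (q (enum_val i) (enum_val j)
   - (i == j)%:R * \sum_z q (enum_val i) z).
have n0 : (0 < #|T|)%N by apply/card_gt0P; exists e.
have dG : \det G = 0.
  rewrite -det_tr; apply/eqP/det0P; exists (const_mx 1).
    apply/rV0Pn; exists (Ordinal n0); by rewrite mxE oner_eq0.
  apply/rowP => i; rewrite !mxE.
  under eq_bigr => j _ do rewrite !mxE mul1r.
  rewrite big_split /= sumrN -mulr_suml.
  have -> : \sum_(j < #|T|) (i == j)%:R = 1 :> R.
    rewrite (bigD1 i) //= eqxx big1 ?addr0 // => j ji.
    by rewrite eq_sym (negbTE ji).
  by rewrite mul1r (big_enum_val (A := T) (q (enum_val i))) subrr.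
have /eqP/det0P[v v0 vG] := dG.
exists [ffun x => v 0 (enum_rank x)].
  move=> y; have := congr1 (fun M : 'rV_ _ => M 0 (enum_rank y)) vG.
  rewrite !mxE; under eq_bigr => j _ do rewrite !mxE enum_rankK mulrBr.
  rewrite big_split /= sumrN => /eqP; rewrite subr_eq0 => /eqP E.
  rewrite ffunE (big_enum_val (A := T) (fun x => [ffun x => v 0 (enum_rank x)] x * q x y)) /=.
  under eq_bigr => i _ do rewrite ffunE enum_valK.
  rewrite E (bigD1 (enum_rank y)) //= eqxx mul1r [X in _ + X]big1 ?addr0 ?enum_rankK //.
  by move=> j /negbTE ->; rewrite mul0r mulr0.
have /rV0Pn[i vi] := v0.
by exists (enum_val i); rewrite ffunE enum_valK.
Qed.

Lemma stationary_unique q e p1 p2 : (forall x y, 0 <= q x y) ->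
  (forall x, connect (fun x y => 0 < q x y) x e) ->
  is_stationary q p1 -> is_stationary q p2 -> p1 = p2.
Proof.
move=> q0 ce [_ s1 b1] [_ s2 b2].
pose w := [ffun x => p1 x + -1 * p2 x].
have bw : balanced q w by exact: balancedD.
have sw : \sum_x w x = 0.
  under eq_bigr => x _ do rewrite ffunE mulN1r.
  by rewrite big_split /= sumrN s1 s2 subrr.
have bn := balanced_norm q0 bw.
have key c : `|c| = 1 -> `|w e| + c * w e = 0 -> forall x, `|w x| + c * w x = 0.
  move=> c1 we x.
  pose m := [ffun x => [ffun x => `|w x|] x + c * w x].
  have mE z : m z = `|w z| + c * w z by rewrite [LHS]ffunE; congr (_ + _); rewrite ffunE.
  rewrite -mE; apply: (balanced_eq0 q0 ce) => [z||]; last by rewrite mE.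
  - rewrite mE -lerBlDr sub0r.
    by rewrite (le_trans (ler_norm _)) // normrN normrM c1 mul1r.
  - exact: balancedD.
have [c c1 we] : exists2 c, `|c| = 1 & `|w e| + c * w e = 0.
  have [h|h] := leP 0 (w e).
    exists (-1); first by rewrite normrN1.
    by rewrite ger0_norm // mulN1r subrr.
  exists 1; first by rewrite normr1.
  by rewrite ltr0_norm // mul1r addNr.
have w0 x : w x = 0.
  have sn : \sum_x `|w x| = 0.
    transitivity (\sum_x (`|w x| + c * w x)).
      by rewrite big_split /= -mulr_sumr sw mulr0 addr0.
    by rewrite big1 // => y _; apply: key.
  by apply: normr0_eq0; apply: (psumr_eq0P _ sn).
by apply/ffunP => x; have := w0 x; rewrite ffunE mulN1r => /eqP; rewrite subr_eq0 => /eqP.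
Qed.

Lemma stationary_exists_unique q e : (forall x y, 0 <= q x y) ->
  (forall x, connect (fun x y => 0 < q x y) x e) ->
  exists! p, is_stationary q p.
Proof.
move=> q0 ce; have [p bp [x px]] := exists_balanced q e.
pose s := \sum_x `|p x|.
have s0 : 0 < s.
  by rewrite /s (bigD1 x) //= ltr_pwDl ?normr_gt0 // sumr_ge0.
have st : is_stationary q [ffun x => `|p x| / s].
  split.
  - by move=> y; rewrite ffunE divr_ge0 // ltW.
  - under eq_bigr => y _ do rewrite ffunE.
    by rewrite -mulr_suml divff // gt_eqF.
  - move=> y; have := balanced_norm q0 bp y; rewrite !ffunE mulrAC => <-.
    by rewrite mulr_suml; apply: eq_bigr => z _; rewrite !ffunE mulrAC.
by exists [ffun x => `|p x| / s]; split=> // p1; exact: stationary_unique st.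
Qed.

End FiniteMarkovChain.

Section OpenTASEP.
Variables (R : realType) (L : nat).

(* The index i : 'I_(2L) stands for the site i - L + 1 in {-L+1, ..., L}. *)
Definition site (i : 'I_(L.*2)) : int := i%:Z - L%:Z + 1.

Definition config := {ffun 'I_(L.*2) -> bool}.

Definition update (eta : config) (i : 'I_(L.*2)) (b : bool) : config :=
  [ffun k => if k == i then b else eta k].

Definition bond_rate (r : R) (k : int) : R := if k == 0 then r else 1.

Definition jump_rate (r a : R) (eta xi : config) : R :=
  \sum_(i | site i == 1 - L%:Z)
    a *+ (~~ eta i && (xi == update eta i true))
  + \sum_i \sum_(j | site j == site i + 1)
      bond_rate r (site i) *+
        [&& eta i, ~~ eta j & xi == update (update eta i false) j true]
  + \sum_(i | site i == L%:Z)
      a *+ (eta i && (xi == update eta i false)).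

(* The unique stationary distribution, see stationary_distrP. *)
Definition stationary_distr (r a : R) : {ffun config -> R} :=
  xget 0 [set p | is_stationary (jump_rate r a) p]%classic.

Definition occupied (eta : config) (k : int) : bool :=
  [exists i, (site i == k) && eta i].

Definition current (r a : R) : R :=
  r * \sum_(eta | occupied eta 0 && ~~ occupied eta 1)
        stationary_distr r a eta.

Lemma jump_rate_ge0 (r a : R) : 0 <= r -> 0 <= a ->
  forall eta xi, 0 <= jump_rate r a eta xi.
Proof.
move=> r0 a0 eta xi; rewrite /jump_rate !addr_ge0 // sumr_ge0 // => i _.
- exact: mulrn_wge0.
- apply: sumr_ge0 => j _; apply: mulrn_wge0; rewrite /bond_rate.
  by case: ifP.
- exact: mulrn_wge0.
Qed.

Lemma connect_empty (r a : R) : 0 < r -> 0 < a -> forall eta,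
  connect (fun x y => 0 < jump_rate r a x y) eta [ffun=> false].
Proof.
move=> r0 a0 eta.
pose pot (eta : config) := (\sum_(i | eta i) (L.*2 - i))%N.
have [n] := ubnP (pot eta); elim: n eta => // n IH eta lt_n.
have pos1 i x : (0 : R) <= bond_rate r x *+ i.
  by apply: mulrn_wge0; rewrite /bond_rate; case: ifP => _ //; exact: ltW.
have posa i : (0 : R) <= a *+ i by apply: mulrn_wge0; exact: ltW.
have [/existsP[i0 ei0]|] := boolP [exists i, eta i]; last first.
  rewrite negb_exists => /forallP h.
  have -> : eta = [ffun=> false] by apply/ffunP => i; rewrite ffunE (negbTE (h i)).
  exact: connect0.
have [i ei imax] := @arg_maxnP _ i0 (fun i => eta i) (fun i => i : nat) ei0.
have pdrop : pot eta = ((L.*2 - i) + pot (update eta i false))%N.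
  rewrite /pot (bigD1 i) //=; congr addn; apply: eq_bigl => k.
  by rewrite ffunE; case: eqP => // _; rewrite ?andbF ?andbT.
have ltiL := ltn_ord i.
have [lti|gei] := ltnP i.+1 L.*2.
  pose j := Ordinal lti.
  have nej : ~~ eta j by apply/negP => /imax /=; rewrite ltnn.
  have nij : (j == i) = false.
    by rewrite -val_eqE /= gtn_eqF.
  pose xi := update (update eta i false) j true.
  have step : 0 < jump_rate r a eta xi.
    rewrite /jump_rate ltr_pwDl ?ltr_wpDl ?sumr_ge0 //.
    rewrite (bigD1 i) //= ltr_pwDl ?sumr_ge0 //; last first.
      by move=> k _; apply: sumr_ge0.
    rewrite (bigD1 j) //=; last by rewrite /site /= intS; apply/eqP; ring.
    rewrite ltr_pwDl ?sumr_ge0 // ei nej eqxx /= mulr1n /bond_rate.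
    by case: ifP.
  apply: connect_trans (connect1 step) (IH _ _).
  rewrite -ltnS; apply: leq_trans lt_n; rewrite ltnS pdrop.
  have -> : pot xi = ((L.*2 - i.+1) + pot (update eta i false))%N.
    rewrite /pot (bigD1 j) ?ffunE ?eqxx //=; congr addn; apply: eq_bigl => k.
    rewrite !ffunE; case: (eqVneq k j) => [->|_]; rewrite ?andbT //=.
    by rewrite nij (negbTE nej).
  by rewrite ltn_add2r ltn_sub2l.
pose xi := update eta i false.
have step : 0 < jump_rate r a eta xi.
  rewrite /jump_rate ltr_wpDl ?addr_ge0 ?sumr_ge0 //.
    by move=> k _; apply: sumr_ge0.
  rewrite (bigD1 i) //=.
    by rewrite ltr_pwDl ?sumr_ge0 // ei eqxx mulr1n.
  have iE : L.*2 = i.+1 by apply/eqP; rewrite eqn_leq gei ltiL.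
  rewrite /site; apply/eqP.
  have : (i.+1)%:Z = L%:Z + L%:Z by rewrite -iE -addnn PoszD.
  by rewrite intS => /(canRL (addKr _)) ->; ring.
apply: connect_trans (connect1 step) (IH _ _).
rewrite -ltnS; apply: leq_trans lt_n; rewrite ltnS pdrop.
by rewrite -[ltnLHS]add0n ltn_add2r subn_gt0.
Qed.

Lemma stationary_distrP (r a : R) : 0 < r -> 0 < a ->
  forall p, is_stationary (jump_rate r a) p <-> p = stationary_distr r a.
Proof.
move=> r0 a0 p.
have q0 := jump_rate_ge0 (ltW r0) (ltW a0); have ce := connect_empty r0 a0.
have [p0 [p0s p0u]] := stationary_exists_unique q0 ce.
have sp : is_stationary (jump_rate r a) (stationary_distr r a).
  by rewrite /stationary_distr; case: xgetP => [q _ //|/(_ p0)].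
by split=> [/(stationary_unique q0 ce)/(_ sp)|->].
Qed.

End OpenTASEP.

(* Main.v *)
(* Holes left of the blockage and particles right of it form two queues of
   length L, fed simultaneously at rate r at their first sites and emptied at
   rate a at their last ones. Let P(u, v) be the stationary probability that the
   two queues start with the words u and v. It is O(r^n) when u or v contains n
   particles. Stationarity gives a linear equation at (u, v) which does not
   involve L and a as long as u and v are shorter than L. Hence the difference Q
   of the functions P of two systems satisfies the same equation, and
   Q(u, v) = O(r^(L1 - z)), where z is the larger of the numbers of empty sites
   in u and in v: the influence of the exit can reach a word of length m with n
   particles only through a jam of L1 - m further particles. The current is
   r P(0, 0), and P(0, 0) = 1 - P(1, _) - P(_, 1) + P(1, 1). *)
Require Import Defs.
From mathcomp Require Import all_boot all_order all_algebra.
From mathcomp Require Import ring lra zify.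
From mathcomp Require Import all_classical all_reals all_analysis.
Import Order.TTheory GRing.Theory Num.Theory.
Import numFieldNormedType.Exports.
Local Open Scope classical_set_scope.
Local Open Scope ring_scope.

Set Implicit Arguments.
Unset Strict Implicit.
Unset Printing Implicit Defensive.

(** * Functions of order r^k *)

Section SmallOrder.
Variable R : realType.
Implicit Types (f g : R -> R) (k : nat).

Definition order_ge k f :=
  exists C, forall r, 0 < r -> r <= 1 -> `|f r| <= C * r ^+ k.

Lemma eq_order_ge k f g : (forall r, 0 < r -> r <= 1 -> f r = g r) ->
  order_ge k f -> order_ge k g.
Proof. by move=> fg [C h]; exists C => r r0 r1; rewrite -fg //; exact: h. Qed.

Lemma order_ge_le j k f : (j <= k)%N -> order_ge k f -> order_ge j f.
Proof.
move=> jk [C h]; exists `|C| => r r0 r1; apply: le_trans (h _ r0 r1) _.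
apply: le_trans (ler_wpM2r (exprn_ge0 _ (ltW r0)) (ler_norm C)) _.
by rewrite ler_wpM2l // ler_wiXn2l // ltW.
Qed.

Lemma order_ge0 k : order_ge k (fun=> 0).
Proof. by exists 0 => r _ _; rewrite normr0 mul0r. Qed.

Lemma order_geD k f g : order_ge k f -> order_ge k g ->
  order_ge k (fun r => f r + g r).
Proof.
move=> [C hf] [D hg]; exists (C + D) => r r0 r1.
by rewrite mulrDl (le_trans (ler_normD _ _)) // lerD ?hf ?hg.
Qed.

Lemma order_geZ k c f : order_ge k f -> order_ge k (fun r => c * f r).
Proof.
move=> [C hf]; exists (`|c| * C) => r r0 r1.
by rewrite normrM -mulrA ler_wpM2l // hf.
Qed.

Lemma order_geB k f g : order_ge k f -> order_ge k g ->
  order_ge k (fun r => f r - g r).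
Proof.
move=> hf /(order_geZ (-1)) hg; apply: eq_order_ge (order_geD hf hg) => r _ _.
by rewrite mulN1r.
Qed.

Lemma order_geX k f : order_ge k f -> order_ge k.+1 (fun r => r * f r).
Proof.
move=> [C hf]; exists C => r r0 r1.
by rewrite normrM gtr0_norm // exprS mulrCA ler_pM2l // hf.
Qed.

End SmallOrder.

(** * A single queue and its action on prefix events *)

Section Queue.
Variable R : realType.
Implicit Types (a : R) (u v w x y : seq bool) (f g : seq bool -> R).

(* Particles hop to the right at rate 1 and leave the last site at rate a. *)
Fixpoint queue_gen a y g : R :=
  if y is b :: t then
    (if t is b1 :: t1 then
       (b && ~~ b1)%:R * (g [:: false, true & t1] - g [:: b, b1 & t1])
     else a * b%:R * (g [:: false] - g [:: b]))
    + queue_gen a t (fun z => g (b :: z))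
  else 0.

(* With [f w] the probability that the queue starts with [w], [drift 1 v f] is
   the expectation of [queue_gen a] applied to the event "starts with [v]", the
   event that the site following [v] is empty being written as a difference. *)
Fixpoint drift a v f : R :=
  if v is c :: t then
    (if t is c1 :: t1 then
       (~~ c && c1)%:R * f [:: true, false & t1]
       - (c && ~~ c1)%:R * f [:: c, c1 & t1]
     else a * ((~~ c)%:R * (f [:: true] - f [:: true; true])
               - c%:R * (f [:: c] - f [:: c; true])))
    + drift a t (fun z => f (c :: z))
  else 0.

(** Minus the coefficient of [f v] in [drift a v f]. *)
Fixpoint exit_rate a v : R :=
  if v is c :: t then
    (if t is c1 :: _ then (c && ~~ c1)%:R else a * c%:R) + exit_rate a t
  else 0.

(** The predecessor of a word by an internal hop, or the word with its last site filled, followed by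
    a particle, or both. Every such change raises the potential defined below. *)
Inductive upstream : seq bool -> seq bool -> Prop :=
| Upstream_hop t : upstream [:: false, true & t] [:: true, false & t]
| Upstream_jam : upstream [:: true] [:: true; true]
| Upstream_fill : upstream [:: false] [:: true]
| Upstream_fill_jam : upstream [:: false] [:: true; true]
| Upstream_cons c v w : upstream v w -> upstream (c :: v) (c :: w).

Lemma eq_queue_gen a y g h : g =1 h -> queue_gen a y g = queue_gen a y h.
Proof.
elim: y g h => //= b t IH g h gh.
congr (_ + _); last by apply: IH => z; rewrite gh.
by case: t {IH} => [|b1 t1]; rewrite !gh.
Qed.

Lemma queue_genZ a y c g :
  queue_gen a y (fun z => c * g z) = c * queue_gen a y g.
Proof.
elim: y g => [|b t IH] g /=; first by rewrite mulr0.
by rewrite IH [in RHS]mulrDr; congr (_ + _); case: t {IH} => [|b1 t1]; ring.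
Qed.

Lemma queue_gen_cst a y c : queue_gen a y (fun=> c) = 0.
Proof. by elim: y => //= b [|b1 t1] ->; rewrite subrr mulr0 addr0. Qed.

(** The recursive form suits induction on words; this one, indexed by positions, is matched with the
    bond sum of the exclusion process. *)
Lemma queue_genE a y g : queue_gen a y g =
  \sum_(0 <= k < (size y).-1) (nth false y k && ~~ nth false y k.+1)%:R *
     (g (set_nth false (set_nth false y k false) k.+1 true) - g y)
  + a * (last false y)%:R * (g (set_nth false y (size y).-1 false) - g y).
Proof.
elim: y g => [|b [|b1 t] IH] g.
- by rewrite /= big_geq // mulr0 mul0r addr0.
- by rewrite /= big_geq // add0r addr0.
- rewrite -[LHS]/((b && ~~ b1)%:R * (g [:: false, true & t] - g [:: b, b1 & t])
    + queue_gen a (b1 :: t) (fun z => g (b :: z))).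
  by rewrite IH big_nat_recl // addrA.
Qed.

Lemma drift_sum (I : Type) (s : seq I) a v (c : I -> R) (h : I -> seq bool -> R) :
  drift a v (fun w => \sum_(i <- s) c i * h i w) =
  \sum_(i <- s) c i * drift a v (h i).
Proof.
elim: v h => [|b t IH] h /=; first by rewrite big1 // => i _; rewrite mulr0.
rewrite IH; under [RHS]eq_bigr => i _ do rewrite mulrDr.
rewrite big_split /=; congr (_ + _).
case: t {IH} => [|b1 t1]; rewrite -?sumrB !mulr_sumr -?sumrB ?mulr_sumr;
  by apply: eq_bigr => i _; ring.
Qed.

Lemma driftB a v f g :
  drift a v (fun w => f w - g w) = drift a v f - drift a v g.
Proof.
elim: v f g => [|b t IH] f g /=; first by rewrite subr0.
by rewrite IH; case: t {IH} => [|b1 t1]; ring.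
Qed.

Lemma driftZ a v c f : drift a v (fun w => c * f w) = c * drift a v f.
Proof.
elim: v f => [|b t IH] f /=; first by rewrite mulr0.
by rewrite IH; case: t {IH} => [|b1 t1]; ring.
Qed.

Lemma eq_drift a v f g : f =1 g -> drift a v f = drift a v g.
Proof.
elim: v f g => //= b t IH f g fg.
congr (_ + _); last by apply: IH => z; rewrite fg.
by case: t {IH} => [|b1 t1]; rewrite !fg.
Qed.

Definition cylinder v y : R := (prefix v y)%:R.

Lemma cylinder_cons c v b y :
  cylinder (c :: v) (b :: y) = (c == b)%:R * cylinder v y.
Proof. by rewrite /cylinder /=; case: eqP; rewrite ?mul1r ?mul0r. Qed.

(** Only hops inside [v] or out of its last site change the indicator. If [v] is shorter than the
    queue, the latter occur at rate 1 and need an empty next site. If [v] fills the queue, they are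
    exits at rate [a], and the same formula applies because a longer word is never a prefix. *)
Lemma queue_gen_cylinder a v y : (size v <= size y)%N ->
  queue_gen a y (cylinder v) =
  drift (if size v == size y then a else 1) v (cylinder^~ y).
Proof.
elim: v y => [|c v IH] [|b y] //= vy; first exact: (queue_gen_cst a (b :: y) 1).
rewrite (@eq_queue_gen a y _ (fun z => (c == b)%:R * cylinder v z)); last first.
  by move=> z; rewrite cylinder_cons.
rewrite (@eq_drift _ v _ (fun z => (c == b)%:R * cylinder z y)); last first.
  by move=> z; rewrite cylinder_cons.
rewrite queue_genZ driftZ eqSS IH //; congr (_ + _).
case: v y {IH} vy => [|c1 v] [|b1 y] //= _.
- by rewrite /cylinder; case: b; case: c => /=; ring.
- by rewrite /cylinder; case: b; case: c; case: b1 => /=; rewrite ?prefix0s /=; ring.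
- by rewrite /cylinder; case: b; case: c; case: b1; case: c1 => /=;
     rewrite ?mul0r ?mul1r ?subr0 ?sub0r ?subrr ?mulr0 ?oppr0.
Qed.

Lemma cylinder_rcons v y : (size v < size y)%N ->
  cylinder v y = cylinder (rcons v false) y + cylinder (rcons v true) y.
Proof.
elim: v y => [|c v IH] [|b y] // vy.
  by rewrite /cylinder /=; case: b {vy}; rewrite ?prefix0s /= ?add0r ?addr0.
by rewrite !rcons_cons !cylinder_cons IH // mulrDr.
Qed.

Lemma exit_rate_ge0 a v : 0 <= a -> 0 <= exit_rate a v.
Proof.
move=> a0; elim: v => //= c t IH; rewrite addr_ge0 //.
by case: t {IH} => [|c1 t]; rewrite ?mulr_ge0.
Qed.

(** The last particle of [v] is followed by an empty site or by the end of [v], so it contributes 1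
    or [a]. *)
Lemma exit_rate_gt0 a v : 0 < a -> true \in v -> 0 < exit_rate a v.
Proof.
move=> a0; elim: v => //= c t IH; have [tt _|tt] := boolP (true \in t).
  rewrite ltr_wpDl ?IH //; case: t {IH tt} => [|c1 t] //.
  by rewrite mulr_ge0 // ltW.
rewrite in_cons (negPf tt) orbF => /eqP <-.
rewrite ltr_pwDl ?exit_rate_ge0 // ?ltW //.
by case: t {IH} tt => [|[|] t]; rewrite ?mulr1.
Qed.

(* All terms of the drift at [v] other than those in [f v] are upstream. *)
Lemma drift_order (F : R -> seq bool -> R) a v k :
  (forall w, upstream v w -> order_ge k (F^~ w)) ->
  order_ge k (fun r => drift a v (F r) + exit_rate a v * F r v).
Proof.
elim: v F => [|c t IH] F up /=.
  by apply: eq_order_ge (order_ge0 R k) => r _ _; rewrite mul0r addr0.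
have {}IH := IH (fun r z => F r (c :: z)) (fun w tw => up _ (Upstream_cons c tw)).
pose hd r := if t is c1 :: t1 then
    (~~ c && c1)%:R * F r [:: true, false & t1]
  else a * ((~~ c)%:R * (F r [:: true] - F r [:: true; true])
            + c%:R * F r [:: c; true]).
suff hdk : order_ge k hd.
  apply: eq_order_ge (order_geD hdk IH) => r _ _.
  by rewrite /hd; case: t {IH hdk hd up} => [|c1 t1]; ring.
rewrite /hd; case: t c {IH hd} up => [|c1 t1] [] up.
- have u1 := up _ Upstream_jam.
  by apply: eq_order_ge (order_geZ a u1) => r _ _ /=; ring.
- have u1 := up _ Upstream_fill; have u2 := up _ Upstream_fill_jam.
  by apply: eq_order_ge (order_geZ a (order_geB u1 u2)) => r _ _ /=; ring.
- by apply: eq_order_ge (order_ge0 R k) => r _ _; rewrite mul0r.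
- case: c1 up => up; last by apply: eq_order_ge (order_ge0 R k) => r _ _; rewrite mul0r.
  exact: order_geZ (up _ (Upstream_hop t1)).
Qed.

End Queue.

(** * A potential that grows upstream, and counts of particles and empty sites *)

Section Potential.
Implicit Types (u v w : seq bool) (N : nat).

(** A particle at position k weighs N - k. Moving it one step back gains 1, and an added particle
    has positive weight as long as its position is below N. *)
Fixpoint potential N v : nat :=
  if v is b :: t then (b * N + potential N.-1 t)%N else 0%N.

Lemma potential_le N v : (potential N v <= size v * N)%N.
Proof.
elim: v N => //= b t IH N; rewrite mulSn leq_add //; first by case: b; lia.
by apply: leq_trans (IH _) _; rewrite leq_mul2l leq_pred orbT.
Qed.

Lemma potential_upstream N v w : upstream v w -> (size v < N)%N ->
  (potential N v < potential N w)%N.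
Proof.
move=> vw; elim: vw N => [t||||c {}v {}w _ IH] N /=; try lia.
by move=> vN; rewrite ltn_add2l IH //; lia.
Qed.

Lemma mem_true_upstream v w : upstream v w -> true \in w.
Proof. by elim=> *; rewrite ?inE //=; apply/orP; right. Qed.

Lemma count_true_upstream v w : upstream v w ->
  (count id v <= count id w)%N.
Proof. by elim=> //= *; rewrite ?leq_add2l. Qed.

Lemma count_false_upstream v w : upstream v w ->
  (count negb w <= count negb v)%N.
Proof. by elim=> //= *; rewrite ?leq_add2l. Qed.

(** The empty word does not constrain the first site, so it is compatible with both values. *)
Definition starts (b : bool) v := if v is c :: _ then c == b else true.

Definition has_true u v := (true \in u) || (true \in v).

(** The empty word becomes a word of length 1: an injection requires the first site to be empty even
    if the word says nothing about it. *)
Definition empty_first v := false :: behead v.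

End Potential.

(** * Bootstrap of orders from a stationarity equation *)

Section Bootstrap.
Variable R : realType.
(** [d] is the order to be proved, [D] the set of pairs where the equation is used, and [N] bounds
    the lengths of their words. *)
Variables (P : R -> seq bool -> seq bool -> R) (d : seq bool -> seq bool -> nat).
Variables (D : seq bool -> seq bool -> bool) (N : nat).

(** Gain minus loss of the event (u, v) in a simultaneous injection; the two cancel when both words
    are empty. *)
Definition injection_coef (u v : seq bool) : R :=
  (starts true u && starts true v)%:R - (starts false u && starts false v)%:R.

Hypothesis D_size : forall u v, D u v ->
  [/\ (size u <= N)%N, (size v <= N)%N & has_true u v].
Hypothesis D_eq : forall u v, D u v -> exists a b, [/\ 0 < a, 0 < b &
  forall r, 0 < r -> r <= 1 ->
    drift a u (P r ^~ v) + drift b v (P r u)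
    + r * (injection_coef u v * P r (empty_first u) (empty_first v)) = 0].
Hypothesis d_upl : forall u v w, D u v -> upstream u w -> (d u v <= d w v)%N.
Hypothesis d_upr : forall u v w, D u v -> upstream v w -> (d u v <= d u w)%N.
Hypothesis d_inj : forall u v, D u v ->
  (d u v <= (d (empty_first u) (empty_first v)).+1)%N.
Hypothesis P_bounded : forall u v, order_ge 0 (fun r => P r u v).
Hypothesis P_boundary : forall u v, has_true u v -> ~~ D u v ->
  order_ge (d u v) (fun r => P r u v).
(** Without particles both exit rates vanish and the equation cannot be solved for [P r u v]; its
    order has to come from words with particles. *)
Hypothesis P_empty : forall k u v, ~~ has_true u v ->
  (forall u' v', has_true u' v' ->
    order_ge (minn (d u' v') k) (fun r => P r u' v')) ->
  order_ge (minn (d u v) k) (fun r => P r u v).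

(* Induction on the order [k] up to which the claim is known; at a given [k],
   the equation at [(u, v)] involves order [k] terms at configurations of larger
   potential only, the injection term being controlled through its factor [r]. *)
Lemma bootstrap u v : order_ge (d u v) (fun r => P r u v).
Proof.
suff H k u' v' : order_ge (minn (d u' v') k) (fun r => P r u' v').
  by have := H (d u v) u v; rewrite minnn.
elim: k u' v' => [|k IHk] {}u {}v; first by rewrite minn0.
suff HD u' v' : has_true u' v' ->
    order_ge (minn (d u' v') k.+1) (fun r => P r u' v').
  by have [/HD //|tuv] := boolP (has_true u v); apply: P_empty.
pose pot u v := (potential N.+1 u + potential N.+1 v)%N.
(* [B] exceeds the potential of every pair in [D], so the truncated [B - pot] drops strictly at each
   upstream step from [D]. *)
pose B := (N * N.+1 + N * N.+1).+1%N.
have [n] := ubnP (B - pot u' v'); elim: n u' v' => // n IHn {}u {}v lt_n tuv.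
have [Duv|nD] := boolP (D u v); last first.
  exact: order_ge_le (geq_minl _ _) (P_boundary tuv nD).
have [su sv _] := D_size Duv.
have potB : (pot u v < B)%N.
  by rewrite ltnS leq_add // (leq_trans (potential_le _ _)) // leq_mul2r ?su ?sv orbT.
have step u' v' : has_true u' v' -> (pot u v < pot u' v')%N -> (d u v <= d u' v')%N ->
    order_ge (minn (d u v) k.+1) (fun r => P r u' v').
  move=> tuv' ltp led; apply: (@order_ge_le _ _ (minn (d u' v') k.+1)).
    by rewrite leq_min geq_minr andbT (leq_trans (geq_minl _ _)).
  by apply: IHn => //; lia.
have [a [b [a0 b0 E]]] := D_eq Duv.
have hu : order_ge (minn (d u v) k.+1)
    (fun r => drift a u (P r ^~ v) + exit_rate a u * P r u v).
  apply: (@drift_order _ (fun r w => P r w v)) => w uw; apply: step.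
  - by rewrite /has_true (mem_true_upstream uw).
  - by rewrite ltn_add2r potential_upstream.
  - exact: d_upl.
have hv : order_ge (minn (d u v) k.+1)
    (fun r => drift b v (P r u) + exit_rate b v * P r u v).
  apply: (@drift_order _ (fun r => P r u)) => w vw; apply: step.
  - by rewrite /has_true (mem_true_upstream vw) orbT.
  - by rewrite ltn_add2l potential_upstream.
  - exact: d_upr.
have hi : order_ge (minn (d u v) k.+1) (fun r =>
    r * (injection_coef u v * P r (empty_first u) (empty_first v))).
  apply: (@order_ge_le _ _ (minn (d (empty_first u) (empty_first v)) k).+1).
    by have := d_inj Duv; lia.
  exact/order_geX/order_geZ.
(* By the equation the three bounded expressions add up to [c * P r u v]. The rates were chosen
   before r, so dividing by [c] only changes the constant. *)
pose c := exit_rate a u + exit_rate b v.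
have c0 : 0 < c.
  rewrite /c; case/orP: tuv => t.
    by rewrite ltr_pwDl ?exit_rate_gt0 ?exit_rate_ge0 // ltW.
  by rewrite ltr_wpDl ?exit_rate_gt0 ?exit_rate_ge0 // ltW.
apply: eq_order_ge (order_geZ c^-1 (order_geD (order_geD hu hv) hi)) => r r0 r1.
have := E r r0 r1; set x := drift a u _; set y := drift b v _; set z := r * _.
move=> E0; have -> : x + exit_rate a u * P r u v + (y + exit_rate b v * P r u v) + z
    = c * P r u v by rewrite /c; lra.
by rewrite mulKf // gt_eqF.
Qed.

End Bootstrap.

(** * The exclusion process as a pair of queues *)

Section ConfigQueues.
Variables (R : realType) (L : nat).
Hypothesis L_gt0 : (0 < L)%N.
Implicit Types (eta : config L) (n k : nat) (b : bool).

(** Sites are indexed by natural numbers so that bonds form an integer range; indices outside the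
    lattice count as empty. *)
Definition occ eta n : bool := [exists i, (val i == n) && eta i].

Definition upd eta n b : config L := [ffun i => if val i == n then b else eta i].

(* Both queues are listed from the blockage outwards. *)
Definition holes eta := mkseq (fun k => ~~ occ eta (L.-1 - k)) L.
Definition particles eta := mkseq (fun k => occ eta (L + k)) L.

Lemma occ_ord eta (i : 'I_(L.*2)) : occ eta i = eta i.
Proof.
apply/existsP/idP => [[j /andP[/eqP ji]]|ei]; first by rewrite (val_inj ji).
by exists i; rewrite eqxx.
Qed.

Lemma occ_upd eta n b m : (n < L.*2)%N ->
  occ (upd eta n b) m = if m == n then b else occ eta m.
Proof.
move=> n2; have [m2|m2] := ltnP m L.*2.
  by rewrite -[m]/(val (Ordinal m2)) !occ_ord ffunE.
have mn : (m == n) = false by apply/eqP; lia.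
have out xi : occ xi m = false.
  by apply/negbTE/negP => /existsP[i /andP[/eqP im _]]; have := ltn_ord i; rewrite im ltnNge m2.
by rewrite mn !out.
Qed.

Lemma holes_upd eta k b : (k < L)%N ->
  holes (upd eta (L.-1 - k) b) = set_nth false (holes eta) k (~~ b).
Proof.
move=> kL; apply: (@eq_from_nth _ false).
  by rewrite size_set_nth !size_mkseq; lia.
move=> i; rewrite size_mkseq => iL.
rewrite nth_set_nth /= !nth_mkseq // occ_upd; last by lia.
have -> : (L.-1 - i == L.-1 - k)%N = (i == k) by lia.
by case: eqP.
Qed.

Lemma holes_upd_right eta k b : (k < L)%N -> holes (upd eta (L + k) b) = holes eta.
Proof.
move=> kL; apply: (@eq_from_nth _ false); first by rewrite !size_mkseq.
move=> i; rewrite size_mkseq => iL.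
rewrite !nth_mkseq // occ_upd; last by lia.
by case: eqP => //; lia.
Qed.

Lemma particles_upd eta k b : (k < L)%N ->
  particles (upd eta (L + k) b) = set_nth false (particles eta) k b.
Proof.
move=> kL; apply: (@eq_from_nth _ false).
  by rewrite size_set_nth !size_mkseq; lia.
move=> i; rewrite size_mkseq => iL.
rewrite nth_set_nth /= !nth_mkseq // occ_upd; last by lia.
by rewrite eqn_add2l; case: eqP.
Qed.

Lemma particles_upd_left eta k b : (k < L)%N ->
  particles (upd eta (L.-1 - k) b) = particles eta.
Proof.
move=> kL; apply: (@eq_from_nth _ false); first by rewrite !size_mkseq.
move=> i; rewrite size_mkseq => iL.
rewrite !nth_mkseq // occ_upd; last by lia.
by case: eqP => //; lia.
Qed.

Lemma update_upd eta i b : update eta i b = upd eta i b.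
Proof. by apply/ffunP => k; rewrite !ffunE. Qed.

Lemma sum_target (T : finType) (c : R) b (z : T) (h : T -> R) :
  \sum_x (c *+ (b && (x == z))) * h x = c * b%:R * h z.
Proof.
rewrite (bigD1 z) //= eqxx andbT big1 ?addr0 ?mulr_natr // => x /negbTE ->.
by rewrite andbF mul0r.
Qed.

(** The index n stands for the site n - L + 1, so the blocked bond starts at n = L - 1. *)
Lemma sum_jump_rate (r a : R) (F : config L -> R) eta :
  \sum_xi jump_rate r a eta xi * (F xi - F eta) =
  a * (~~ occ eta 0)%:R * (F (upd eta 0 true) - F eta)
  + \sum_(0 <= n < L.*2.-1) (if n == L.-1 then r else 1) *
      (occ eta n && ~~ occ eta n.+1)%:R *
      (F (upd (upd eta n false) n.+1 true) - F eta)
  + a * (occ eta L.*2.-1)%:R * (F (upd eta L.*2.-1 false) - F eta).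
Proof.
under eq_bigr => xi _ do rewrite /jump_rate !mulrDl !mulr_suml.
rewrite !big_split /=; congr (_ + _ + _).
- rewrite exchange_big /=.
  under eq_bigr => i _ do rewrite (sum_target _ _ _ (fun xi => F xi - F eta))
    update_upd -occ_ord.
  under eq_bigl => i.
    have -> : (site i == 1 - L%:Z) = (i == 0%N :> nat) by rewrite /site; lia.
  over.
  rewrite (big_ord1_eq _ (fun n => a * (~~ occ eta n)%:R * (F (upd eta n true) - F eta))).
  by rewrite double_gt0 L_gt0.
- rewrite exchange_big /=.
  pose h n m := (if n == L.-1 then r else 1) * (occ eta n && ~~ occ eta m)%:R *
    (F (upd (upd eta n false) m true) - F eta).
  transitivity (\sum_(i < L.*2) \sum_(j < L.*2 | j == i.+1 :> nat) h i j).
    apply: eq_bigr => i _; under eq_bigr => xi _ do rewrite mulr_suml.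
    rewrite exchange_big /=; apply: eq_big => [j|j _].
      by rewrite /site; lia.
    under eq_bigr => xi _ do rewrite andbA.
    rewrite (sum_target _ _ _ (fun xi => F xi - F eta)) !update_upd -!occ_ord.
    rewrite /h /bond_rate; congr (_ * _ * _).
    by have -> : (site i == 0) = (i == L.-1 :> nat) by rewrite /site; lia.
  transitivity (\sum_(0 <= n < L.*2) if (n.+1 < L.*2)%N then h n n.+1 else 0).
    by rewrite big_mkord; apply: eq_bigr => i _; exact: (big_ord1_eq _ (h i)).
  (* The last site has no right neighbour; its zero term is split off. *)
  have L2 : L.*2 = L.*2.-1.+1 by rewrite prednK ?double_gt0.
  rewrite [in index_iota _ _]L2 big_nat_recr //= -L2 ltnn addr0.
  by apply: eq_big_nat => n /= nL; rewrite ifT // L2 ltnS.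
- rewrite exchange_big /=.
  under eq_bigr => i _ do rewrite (sum_target _ _ _ (fun xi => F xi - F eta))
    update_upd -occ_ord.
  under eq_bigl => i.
    have -> : (site i == L%:Z) = (i == L.*2.-1 :> nat) by rewrite /site; lia.
  over.
  rewrite (big_ord1_eq _ (fun n => a * (occ eta n)%:R * (F (upd eta n false) - F eta))).
  by rewrite prednK ?double_gt0 // leqnn.
Qed.

(** A particle hop on the left is a hole hop away from the blockage, the entry of a particle is the
    exit of a hole, and a jump across the blockage fills the first site of both queues. *)
Lemma sum_jump_rate_queues (r a : R) (g : seq bool -> seq bool -> R) eta :
  \sum_xi jump_rate r a eta xi *
    (g (holes xi) (particles xi) - g (holes eta) (particles eta)) =
  queue_gen a (holes eta) (g ^~ (particles eta))
  + queue_gen a (particles eta) (g (holes eta))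
  + r * (~~ head false (holes eta) && ~~ head false (particles eta))%:R *
    (g (set_nth false (holes eta) 0 true) (set_nth false (particles eta) 0 true)
     - g (holes eta) (particles eta)).
Proof.
rewrite (sum_jump_rate r a (fun xi => g (holes xi) (particles xi))).
have nH k : (k < L)%N -> nth false (holes eta) k = ~~ occ eta (L.-1 - k).
  by move=> kL; rewrite nth_mkseq.
have nP k : (k < L)%N -> nth false (particles eta) k = occ eta (L + k).
  by move=> kL; rewrite nth_mkseq.
rewrite !queue_genE -!nth_last -!nth0 !size_mkseq.
have L1 : (L.-1 < L)%N by rewrite prednK.
have -> : L.*2.-1 = (L + L.-1)%N by lia.
(* The bond sum is cut at the blockage, and its left part is reversed because holes are numbered
   outwards. *)
rewrite (@big_cat_nat _ _ _ L.-1) ?leq_addl //=.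
rewrite [X in _ + (_ + X) + _]big_ltn; last by lia.
rewrite eqxx [X in _ + (X + _) + _]big_nat_rev /= !nH // !nP //.
rewrite subnn subn0 addn0 negbK prednK // holes_upd_right // particles_upd //.
(* The indices 0, L - 1 and L are written as [L.-1 - L.-1], [L.-1 - 0] and [L + 0] to fit the update
   lemmas. *)
rewrite -[X in upd eta X true](subnn L.-1) holes_upd // particles_upd_left //.
rewrite -[X in upd eta X false](subn0 L.-1) -[L in upd _ L true]addn0.
rewrite holes_upd_right // holes_upd // particles_upd // particles_upd_left //=.
set EL := a * _ * _; set ER := a * _ * _; set I := r * _ * _.
set SL := \sum_(_ <= _ < _) _; set SR := \sum_(_ <= _ < _) _.
set HL := \sum_(_ <= _ < _) _; set PR := \sum_(_ <= _ < _) _.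
suff [-> ->] : SL = HL /\ SR = PR by ring.
split.
  apply: eq_big_nat => k /= kL.
  have -> : (0 + L.-1 - k.+1 = L.-1 - k.+1)%N by lia.
  have -> : ((L.-1 - k.+1).+1 = L.-1 - k)%N by lia.
  rewrite ifF; last by lia.
  rewrite !nH ?negbK; [|lia..].
  rewrite !holes_upd ?particles_upd_left; [|lia..].
  (* The source of the particle is the target of the hole, so the two updates come in opposite
     order. *)
  rewrite set_set_nth /= ifF ?mul1r; last by lia.
  by rewrite andbC.
rewrite /SR -[X in \sum_(X <= _ < _) _]add0n [X in \sum_(_ <= _ < X) _]addnC.
rewrite big_addn addnK; apply: eq_big_nat => k /= kL.
rewrite ifF; last by lia.
rewrite addnC -addnS !nP; [|lia..].
by rewrite !particles_upd ?holes_upd_right ?mul1r; [|lia..].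
Qed.

End ConfigQueues.

(** * Stationary probabilities of prefixes *)

Lemma balanced_expect (R : realType) (T : finType) (q : T -> T -> R)
    (p : {ffun T -> R}) (F : T -> R) : balanced q p ->
  \sum_x p x * (\sum_y q x y * (F y - F x)) = 0.
Proof.
move=> bp; under eq_bigr => x _ do
  (under eq_bigr => y _ do rewrite mulrBr; rewrite sumrB mulrBr -mulr_suml).
rewrite sumrB; apply/eqP; rewrite subr_eq0; apply/eqP.
under eq_bigr => x _ do rewrite mulr_sumr.
rewrite exchange_big; apply: eq_bigr => y _ /=.
by rewrite mulrA -bp mulr_suml; apply: eq_bigr => x _; rewrite mulrA.
Qed.

(** An injection changes first letters only, from empty to occupied. Thus it matters only if the
    remaining letters already agree with [u] and [v], that is, if x and y start with the two words
    after [empty_first]. *)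
Lemma cylinder_injection (R : realType) (u v x y : seq bool) :
  (0 < size x)%N -> (0 < size y)%N ->
  (~~ head false x && ~~ head false y)%:R *
    (cylinder R u (set_nth false x 0 true) * cylinder R v (set_nth false y 0 true)
     - cylinder R u x * cylinder R v y) =
  injection_coef R u v *
    (cylinder R (empty_first u) x * cylinder R (empty_first v) y).
Proof.
case: x y => [|b x] [|b' y] //= _ _; rewrite /injection_coef.
by case: u => [|[] u]; case: v => [|[] v]; case: b; case: b';
  rewrite /cylinder /= ?prefix0s /=; ring.
Qed.

Section Marginals.
Variables (R : realType) (L : nat) (a : R).
Hypotheses (L_gt0 : (0 < L)%N) (a_gt0 : 0 < a).
Implicit Types (r : R) (u v : seq bool) (eta : config L).

Definition prefix_prob r u v : R :=
  \sum_eta stationary_distr L r a eta *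
    (cylinder R u (holes eta) * cylinder R v (particles eta)).

Lemma stationary_distr_stationary r : 0 < r ->
  is_stationary (@jump_rate R L r a) (stationary_distr L r a).
Proof. by move=> r0; apply/stationary_distrP. Qed.

Lemma prefix_prob_nil r : 0 < r -> prefix_prob r [::] [::] = 1.
Proof.
move=> /stationary_distr_stationary[_ <- _]; apply: eq_bigr => eta _.
by rewrite /cylinder !prefix0s !mulr1.
Qed.

Lemma cylinder_ge0_le1 v y : 0 <= cylinder R v y <= 1.
Proof. by rewrite /cylinder; case: prefix; rewrite ?lexx ?ler01. Qed.

Lemma prefix_prob_bounded u v : order_ge 0 (fun r => prefix_prob r u v).
Proof.
exists 1 => r r0 _; rewrite mulr1 -(prefix_prob_nil r0).
have [p0 _ _] := stationary_distr_stationary r0.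
have c01 eta : 0 <= cylinder R u (holes eta) * cylinder R v (particles eta) <= 1.
  have /andP[u0 u1] := cylinder_ge0_le1 u (@holes L eta).
  have /andP[v0 v1] := cylinder_ge0_le1 v (@particles L eta).
  by rewrite mulr_ge0 // mulr_ile1.
rewrite ger0_norm ?sumr_ge0 // => [|eta _]; last first.
  by rewrite mulr_ge0 //; case/andP: (c01 eta).
apply: ler_sum => eta _; rewrite ler_wpM2l //.
by rewrite /cylinder !prefix0s mulr1; case/andP: (c01 eta).
Qed.

Lemma prefix_prob_rconsr r u v : (size v < L)%N ->
  prefix_prob r u v =
  prefix_prob r u (rcons v false) + prefix_prob r u (rcons v true).
Proof.
move=> vL; rewrite -big_split; apply: eq_bigr => eta _ /=.
by rewrite [cylinder R v _]cylinder_rcons ?size_mkseq // !mulrDr.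
Qed.

Lemma prefix_prob_rconsl r u v : (size u < L)%N ->
  prefix_prob r u v =
  prefix_prob r (rcons u false) v + prefix_prob r (rcons u true) v.
Proof.
move=> uL; rewrite -big_split; apply: eq_bigr => eta _ /=.
by rewrite [cylinder R u _]cylinder_rcons ?size_mkseq // mulrDl mulrDr.
Qed.

(** Boundary values for the bootstrap in [prefix_prob_order]. *)
Lemma prefix_prob_oversize r u v : (L < size u)%N || (L < size v)%N ->
  prefix_prob r u v = 0.
Proof.
have c0 w y : size y = L -> (L < size w)%N -> cylinder R w y = 0.
  move=> <- wy; rewrite /cylinder; case: (boolP (prefix w y)) => // /size_prefix.
  by rewrite leqNgt wy.
move=> sz; rewrite [LHS]big1 // => eta _; case/orP: sz => sz.
  by rewrite (c0 u) ?size_mkseq // mul0r mulr0.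
by rewrite (c0 v) ?size_mkseq // !mulr0.
Qed.

Definition out_rate v : R := if size v == L then a else 1.

(** Stationarity is tested on a product of two prefix indicators. Each queue generator acts on one
    factor, and [drift] commutes with the expectation by linearity. *)
Lemma prefix_prob_eq r u v : 0 < r -> (size u <= L)%N -> (size v <= L)%N ->
  drift (out_rate u) u (prefix_prob r ^~ v)
  + drift (out_rate v) v (prefix_prob r u)
  + r * (injection_coef R u v * prefix_prob r (empty_first u) (empty_first v)) = 0.
Proof.
move=> r0 uL vL; have [_ _ bal] := stationary_distr_stationary r0.
set p := stationary_distr L r a in bal *.
pose F (x y : seq bool) := cylinder R u x * cylinder R v y.
rewrite -(balanced_expect (fun eta => F (holes eta) (particles eta)) bal).
have -> : drift (out_rate u) u (prefix_prob r ^~ v) = \sum_eta p eta *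
    (queue_gen a (holes eta) (F ^~ (particles eta))).
  rewrite (@eq_drift _ _ _ _ (fun w => \sum_eta
    (p eta * cylinder R v (particles eta)) * cylinder R w (holes eta))); last first.
    by move=> w; apply: eq_bigr => eta _; ring.
  rewrite drift_sum; apply: eq_bigr => eta _; rewrite -mulrA; congr (_ * _).
  rewrite (@eq_queue_gen _ _ _ _
    (fun x => cylinder R v (particles eta) * cylinder R u x)); last first.
    by move=> x; rewrite mulrC.
  by rewrite queue_genZ queue_gen_cylinder size_mkseq.
have -> : drift (out_rate v) v (prefix_prob r u) = \sum_eta p eta *
    (queue_gen a (particles eta) (F (holes eta))).
  rewrite (@eq_drift _ _ _ _ (fun w => \sum_eta
    (p eta * cylinder R u (holes eta)) * cylinder R w (particles eta))); last first.
    by move=> w; apply: eq_bigr => eta _; ring.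
  rewrite drift_sum; apply: eq_bigr => eta _; rewrite -mulrA; congr (_ * _).
  by rewrite queue_genZ queue_gen_cylinder size_mkseq.
rewrite !mulr_sumr -!big_split; apply: eq_bigr => eta _ /=.
rewrite (sum_jump_rate_queues L_gt0 r a F) -[r * _ * _]mulrA /F.
by rewrite cylinder_injection ?size_mkseq //; ring.
Qed.

Lemma current_prefix_prob r :
  current L r a = r * prefix_prob r [:: false] [:: false].
Proof.
rewrite /current [in LHS]big_mkcond /=; congr (_ * _); apply: eq_bigr => eta _.
have -> : occupied eta 0 = occ eta L.-1.
  by apply: eq_existsb => i; congr (_ && _); rewrite /site /=; lia.
have -> : occupied eta 1 = occ eta L.
  by apply: eq_existsb => i; congr (_ && _); rewrite /site /=; lia.
rewrite /holes /particles; case: L L_gt0 eta => // l _ eta.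
rewrite /cylinder /= !prefix0s subn0 addn0.
by do 2 case: occ => /=; rewrite ?mulr0 ?mul0r ?mulr1 ?mulr0.
Qed.

(** Upstream steps never lose particles. Emptying both first sites loses at most one particle in
    each queue, hence at most one order for the maximum, though possibly two for the sum. *)
Lemma prefix_prob_order u v :
  order_ge (maxn (count id u) (count id v)) (fun r => prefix_prob r u v).
Proof.
apply: (@bootstrap R prefix_prob (fun u v => maxn (count id u) (count id v))
  (fun u v => [&& (size u <= L)%N, (size v <= L)%N & has_true u v]) L).
- by move=> {}u {}v /and3P[].
- move=> {}u {}v /and3P[uL vL _]; exists (out_rate u), (out_rate v).
  split; try by rewrite /out_rate; case: ifP.
  by move=> r r0 _; apply: prefix_prob_eq.
- by move=> {}u {}v w _ /count_true_upstream; lia.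
- by move=> {}u {}v w _ /count_true_upstream; lia.
- move=> {}u {}v _; rewrite /empty_first /=.
  have le1 (w : seq bool) : (count id w <= (count id (behead w)).+1)%N.
    by case: w => //= -[]; lia.
  by have := le1 u; have := le1 v; lia.
- exact: prefix_prob_bounded.
- move=> {}u {}v tuv; rewrite tuv andbT negb_and -!ltnNge => sz.
  by apply: eq_order_ge (order_ge0 R _) => r _ _; rewrite prefix_prob_oversize.
- move=> k {}u {}v; rewrite negb_or => /andP[tu tv] _.
  have c0 w : true \notin w -> count id w = 0%N.
    by move=> tw; apply/eqP; rewrite -leqn0 leqNgt -has_count; apply: contra tw
      => /hasP[[]].
  by rewrite !c0 // min0n; apply: prefix_prob_bounded.
Qed.

End Marginals.

(** * Comparison of two systems *)

Section Comparison.
Variables (R : realType) (L1 L2 : nat) (a : R).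
Hypotheses (L1_gt0 : (0 < L1)%N) (L12 : (L1 <= L2)%N) (a_gt0 : 0 < a).

(** Bootstrap on words shorter than [L1]: upstream steps never add empty sites, and [empty_first]
    adds at most one to each word. *)
Lemma prefix_prob_diff_order u v :
  order_ge (minn (L1 - count negb u) (L1 - count negb v))
    (fun r => prefix_prob L2 a r u v - prefix_prob L1 1 r u v).
Proof.
have L2_gt0 := leq_trans L1_gt0 L12; have a1 : 0 < 1 :> R by [].
pose d u v := minn (L1 - count negb u) (L1 - count negb v).
pose P r u v := prefix_prob L2 a r u v - prefix_prob L1 1 r u v.
have dS u' v' : (d u' v' <= (d (empty_first u') (empty_first v')).+1)%N.
  have le1 (w : seq bool) : (count negb (empty_first w) <= (count negb w).+1)%N.
    by case: w => //= *; lia.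
  by have := le1 u'; have := le1 v'; rewrite /d; lia.
apply: (@bootstrap R P d
  (fun u v => [&& (size u < L1)%N, (size v < L1)%N & has_true u v]) L1).
- by move=> {}u {}v /and3P[? ? ?]; split=> //; exact: ltnW.
- move=> {}u {}v /and3P[uL vL _]; exists 1, 1; split=> // r r0 _.
  (* Words shorter than [L1] fill neither system, so both equations have exit rates 1 and can be
     subtracted. *)
  have out (L : nat) (c : R) (w : seq bool) : (size w < L)%N -> out_rate L c w = 1.
    by move=> wL; rewrite /out_rate ltn_eqF.
  have := @prefix_prob_eq R L2 a L2_gt0 a_gt0 r u v r0.
  have := @prefix_prob_eq R L1 1 L1_gt0 a1 r u v r0.
  rewrite !out; [|lia..] => E1 E2; rewrite /P !driftB.
  have {}E1 := E1 (ltnW uL) (ltnW vL).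
  have {}E2 := E2 (ltnW (leq_trans uL L12)) (ltnW (leq_trans vL L12)).
  by rewrite -[RHS](subrr 0) -{1}E2 -E1; ring.
- by move=> {}u {}v w _ /count_false_upstream; rewrite /d; lia.
- by move=> {}u {}v w _ /count_false_upstream; rewrite /d; lia.
- by move=> {}u {}v _; apply: dS.
- by move=> {}u {}v; apply: order_geB; apply: prefix_prob_bounded.
- move=> {}u {}v tuv; rewrite tuv andbT negb_and -!leqNgt => sz.
  (* A word of length at least [L1] has at least [L1] minus its number of empty sites as particles,
     so each probability is separately of the claimed order. *)
  have le : (d u v <= maxn (count id u) (count id v))%N.
    have := count_predC id u; have := count_predC id v.
    rewrite -![count (predC id) _]/(count negb _) /d; lia.
  by apply: order_geB; apply: (order_ge_le le); apply: prefix_prob_order.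
- move=> k {}u {}v uv H.
  have dE i j : d (nseq i false) (nseq j false) = minn (L1 - i) (L1 - j).
    by rewrite /d !count_nseq !mul1n.
  have bounded u' v' : order_ge 0 (fun r => P r u' v').
    by apply: order_geB; apply: prefix_prob_bounded.
  have nseqSr i : nseq i.+1 false = rcons (nseq i false) false.
    by elim: i => //= i ->.
  have has_t u' v' : has_true (rcons u' true) v' /\ has_true u' (rcons v' true).
    by rewrite /has_true !mem_rcons !in_cons orbT.
  (* Empty words are extended one site at a time: the probability of one more empty site is that of
     the shorter word minus that of a particle there, which [H] controls. Once a length exceeds [L1]
     the claimed order is 0. *)
  have Z i j : order_ge (minn (minn (L1 - i) (L1 - j)) k)
      (fun r => P r (nseq i false) (nseq j false)).
    elim: i j => [|i IHi] j.
      elim: j => [|j IHj].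
        apply: (eq_order_ge _ (order_ge0 R _)) => r r0 _.
        by rewrite /P !prefix_prob_nil // subrr.
      have [jL|Lj] := ltnP j L1; last by apply: order_ge_le (bounded _ _); lia.
      apply: (@eq_order_ge _ _ (fun r => P r [::] (nseq j false)
          - P r [::] (rcons (nseq j false) true))) => [r _ _|].
        rewrite nseqSr /P !(prefix_prob_rconsr _ _ _ (v := nseq j false)) ?size_nseq //; first ring.
        exact: leq_trans L12.
      apply: order_geB; first by apply: order_ge_le IHj; lia.
      apply: order_ge_le (H _ _ (has_t _ _).2).
      by rewrite /d -cats1 count_cat count_nseq /=; lia.
    have [iL|Li] := ltnP i L1; last by apply: order_ge_le (bounded _ _); lia.
    apply: (@eq_order_ge _ _ (fun r => P r (nseq i false) (nseq j false)
        - P r (rcons (nseq i false) true) (nseq j false))) => [r _ _|].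
      rewrite nseqSr /P !(prefix_prob_rconsl _ _ (u := nseq i false)) ?size_nseq //; first ring.
      exact: leq_trans L12.
    apply: order_geB; first by apply: order_ge_le (IHi j); lia.
    apply: order_ge_le (H _ _ (has_t _ _).1).
    by rewrite /d -cats1 count_cat !count_nseq /=; lia.
  have nseqE w : true \notin w -> w = nseq (size w) false.
    by elim: w => // -[] w IH; rewrite in_cons //= => /IH {1}->.
  by move: uv; rewrite negb_or => /andP[/nseqE -> /nseqE ->]; rewrite dE.
Qed.

End Comparison.

(** * From prefix probabilities to the current *)

Theorem theorem2 (R : realType) (L2 : nat) (hL2 : (1 <= L2)%N) (L1 : nat)
  (hL1 : (1 <= L1 <= L2)%N) (a : R) (ha : 0 < a) :
  (fun r : R => current L2 r a) =
  (fun r : R => current L1 r 1) +O_ (0^'+) (fun r : R => r ^+ L1.+1).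
Proof.
case/andP: hL1 => L1_gt0 L12.
have [C hC] : order_ge L1.+1 (fun r => current L2 r a - current L1 r 1).
  have D u v := prefix_prob_diff_order L1_gt0 L12 ha u v.
  have h1 := D [:: true] [::]; have h2 := D [::] [:: true].
  have h3 := D [:: true] [:: true].
  (* None of the three pairs has an empty site, so all three differences are of full order [L1]; the
     factor r of the current supplies one more. *)
  rewrite /= !subn0 minnn in h1 h2 h3.
  apply: eq_order_ge (order_geX (order_geB h3 (order_geD h1 h2))) => r r0 r1.
  have ie L (c : R) : (0 < L)%N -> 0 < c -> prefix_prob L c r [:: false] [:: false] =
      1 - (prefix_prob L c r [:: true] [::] + prefix_prob L c r [::] [:: true])
        + prefix_prob L c r [:: true] [:: true].
    move=> L0 c0; rewrite -(@prefix_prob_nil R L c c0 r r0).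
    have -> := @prefix_prob_rconsl R L c r [::] [::] L0.
    have -> := @prefix_prob_rconsr R L c r [:: false] [::] L0.
    have -> := @prefix_prob_rconsl R L c r [::] [:: true] L0.
    by rewrite /=; ring.
  rewrite !current_prefix_prob // !ie //.
  ring.
(* The bound on (0, 1] holds in particular near 0 on the right, with any constant above [|C|]. *)
apply/eqaddOP; exists `|C|; split; first exact: num_real.
move=> M CM; near=> r.
have r0 : 0 < r by near: r; exact: nbhs_right_gt.
have r1 : r <= 1 by near: r; exact: nbhs_right_le.
apply: le_trans (hC r r0 r1) _.
rewrite [`|_ ^+ _|]ger0_norm ?exprn_ge0 ?(ltW r0) //.
rewrite ler_wpM2r ?exprn_ge0 ?(ltW r0) //.
exact: le_trans (ler_norm C) (ltW CM).
Unshelve. all: by end_near.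
Qed.
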